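(* Let $\mathcal{H}$ be a real Hilbert space, let $r\geq1$, and let $A_i:\mathcal{H}\rightrightarrows\mathcal{H}$ be maximally monotone operators for $i=1,\ldots,r$. Let $\gamma>0$ and let $(\lambda_n)_{n=0}^\infty$ be a sequence in $[0,1]$ with $\sum_{n\geq0}\lambda_n(1-\lambda_n)=+\infty$. Let $\beta\in{]0,1[}$ and suppose $q\in\operatorname{ran}\left(\operatorname{Id}+\frac{\gamma}{r(1-\beta)}\sum_{i=1}^rA_i\right)$. Given $x_{1,0},\ldots,x_{r,0}\in\mathcal{H}$, define for $n=0,1,2,\ldots$ \[ p_n=\frac{1}{r}\sum_{i=1}^r x_{i,n},\qquad x_{i,n+1}=(1-\lambda_n)x_{i,n}+\lambda_n\left(2\beta J_{(\gamma(A_i)_{-q})}-\operatorname{Id}\right)\left(2 p_n-x_{i,n}\right),\quad i=1,\ldots,r. \] Then: (i) $(x_{i,n+1}-x_{i,n})_{n=0}^\infty$ converges strongly to $0$ for all $i$; (ii) for each $i$, $(x_{i,n})_{n=0}^\infty$ converges weakly to some $x_i^\star\in\mathcal{H}$, and $q+\frac{1}{\beta r}\sum_{i=1}^r x_i^\star=J_{\frac{\gamma}{r(1-\beta)}\sum_{i=1}^rA_i}(q)$; (iii) $\left(q+\frac{1}{\beta}p_n\right)_{n=0}^\infty$ converges strongly to $J_{\frac{\gamma}{r(1-\beta)}\sum_{i=1}^rA_i}(q)$.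
   Context: For an operator $T:\mathcal{H}\rightrightarrows\mathcal{H}$, the resolvent is $J_T:=(\operatorname{Id}+T)^{-1}$; for maximally monotone $T$ it is single-valued with full domain. For $w\in\mathcal{H}$, the inner $w$-perturbation is $T_w(x):=T(x-w)$; thus $\gamma(A_i)_{-q}$ denotes $x\mapsto\gamma A_i(x+q)$. $\operatorname{ran}$ denotes the range. *)

(* Defs.v *)
From HB Require Import structures.
From mathcomp Require Import all_boot all_order all_algebra.
From mathcomp Require Import all_classical all_reals all_analysis.
Set Implicit Arguments. Unset Strict Implicit. Unset Printing Implicit Defensive.
Import Order.TTheory GRing.Theory Num.Theory.
Import numFieldNormedType.Exports.
Local Open Scope classical_set_scope.
Local Open Scope ring_scope.

(* A real Hilbert space: a complete real normed space whose norm is induced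
   by the (symmetric, bilinear) inner product [ip]. *)
Definition is_inner_product (R : realType) (H : completeNormedModType R)
  (ip : H -> H -> R) : Prop :=
  (forall x y, ip x y = ip y x) /\
  (forall (a : R) (x y z : H), ip (a *: x + y) z = a * ip x z + ip y z) /\
  (forall x, ip x x = `|x| ^+ 2).

Definition monotone_op (R : realType) (H : completeNormedModType R)
  (ip : H -> H -> R) (T : H -> set H) : Prop :=
  forall x y u v, T x u -> T y v -> 0 <= ip (x - y) (u - v).

Definition maximally_monotone (R : realType) (H : completeNormedModType R)
  (ip : H -> H -> R) (T : H -> set H) : Prop :=
  monotone_op ip T /\
  forall T' : H -> set H, monotone_op ip T' ->
    (forall x, T x `<=` T' x) -> forall x, T' x = T x.

Definition resolvent_op (R : realType) (H : completeNormedModType R)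
  (T : H -> set H) (x : H) : set H :=
  [set y | exists u, T y u /\ x = y + u].

(* The resolvent as a function (meaningful when J_T is single-valued with full
   domain, e.g. T maximally monotone): picks the element of J_T x. *)
Definition resolvent (R : realType) (H : completeNormedModType R)
  (T : H -> set H) (x : H) : H := get (resolvent_op T x).

Definition ran_IdplusT (R : realType) (H : completeNormedModType R)
  (T : H -> set H) : set H :=
  [set z | exists y u, T y u /\ z = y + u].

Definition scale_op (R : realType) (H : completeNormedModType R)
  (c : R) (T : H -> set H) (x : H) : set H := [set c *: u | u in T x].

Definition perturb_op (R : realType) (H : completeNormedModType R)
  (w : H) (T : H -> set H) (x : H) : set H := T (x - w).

Definition sum_op (R : realType) (H : completeNormedModType R) (r : nat)
  (A : 'I_r -> H -> set H) (x : H) : set H :=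
  [set y | exists u : 'I_r -> H, (forall i, A i x (u i)) /\ y = \sum_(i < r) u i].

Definition weak_cvg (R : realType) (H : completeNormedModType R)
  (ip : H -> H -> R) (u : nat -> H) (l : H) : Prop :=
  forall y, (fun n => ip (u n) y) @ \oo --> ip l y.

(* Main.v *)
(* With y_i = J_{gamma (A_i)_{-q}}(2 p - x_i), one step of the method is
   x_i <- x_i + 2 lambda (beta y_i - p): a Krasnoselskii-Mann iteration in H^r
   for a map N which, by firm nonexpansiveness of the resolvents, satisfies
     |N x - N x'|^2 + 4 beta (1 - beta) sum_i |y_i - y_i'|^2 <= |x - x'|^2.
   The fixed points of N are the f with mean beta y and
   2 beta y - f_i - y in gamma A_i(y + q), where y + q = J(q). Fejer monotonicity
   gives N x_n - x_n -> 0, and the extra term makes every y_{i,n} converge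
   strongly to y, so that p_n -> beta y. For a weak cluster point c of x_n,
   maximality and the strong convergence of y_{i,n} make c a fixed point, and
   Opial's argument shows that there is only one cluster point. *)
Require Import Defs.
From HB Require Import structures.
From mathcomp Require Import all_boot all_order all_algebra.
From mathcomp Require Import all_classical all_reals all_analysis.
From mathcomp Require Import ring lra.
Set Implicit Arguments.
Unset Strict Implicit.
Unset Printing Implicit Defensive.
Import Order.TTheory GRing.Theory Num.Theory.
Import numFieldNormedType.Exports.
Local Open Scope classical_set_scope.
Local Open Scope ring_scope.

(** * Positive definite symmetric bilinear forms *)

(** Stated on a bare vector space, so that it covers both [ip] on [H] and the sum form [prod_ip] on
    ['I_r -> H]. *)
Definition inner_form (R : realType) (E : lmodType R) (B : E -> E -> R) :=
  [/\ forall x y, B x y = B y x,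
      forall (a : R) (x y z : E), B (a *: x + y) z = a * B x z + B y z,
      forall x, 0 <= B x x &
      forall x, B x x = 0 -> x = 0].

Section InnerForm.
Variables (R : realType) (E : lmodType R) (B : E -> E -> R).
Hypothesis hB : inner_form B.

Lemma iformC x y : B x y = B y x. Proof. by case: hB. Qed.

Lemma iform_ge0 x : 0 <= B x x. Proof. by case: hB. Qed.

Lemma iform_eq0 x : B x x = 0 -> x = 0. Proof. by case: hB => _ _ _; apply. Qed.

Lemma iformDl x y z : B (x + y) z = B x z + B y z.
Proof. by case: hB => _ lin _ _; rewrite -[x]scale1r lin mul1r scale1r. Qed.

Lemma iform0l z : B 0 z = 0.
Proof. by apply: (addrI (B 0 z)); rewrite -iformDl !addr0. Qed.

Lemma iformZl a x z : B (a *: x) z = a * B x z.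
Proof. by case: hB => _ lin _ _; rewrite -[a *: x]addr0 lin iform0l addr0. Qed.

Lemma iformNl x z : B (- x) z = - B x z.
Proof. by rewrite -scaleN1r iformZl mulN1r. Qed.

Lemma iformDr x y z : B z (x + y) = B z x + B z y.
Proof. by rewrite ![B z _]iformC iformDl. Qed.

Lemma iformZr a x z : B z (a *: x) = a * B z x.
Proof. by rewrite ![B z _]iformC iformZl. Qed.

Lemma iformNr x z : B z (- x) = - B z x.
Proof. by rewrite ![B z _]iformC iformNl. Qed.

Lemma iform0r z : B z 0 = 0.
Proof. by rewrite iformC iform0l. Qed.

Lemma iform_suml I (s : seq I) (P : pred I) (f : I -> E) z :
  B (\sum_(i <- s | P i) f i) z = \sum_(i <- s | P i) B (f i) z.
Proof.
by elim/big_rec2: _ => [|i y1 y2 _ <-]; rewrite ?iform0l ?iformDl.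
Qed.

Definition iformE := (iformDl, iformDr, iformNl, iformNr, iformZl, iformZr, iform0l, iform0r).

End InnerForm.

(** * Krasnoselskii-Mann iterations *)

(** Here [e n] stands for [N (x n) - x n]; nonexpansiveness of [N] enters only between consecutive
    iterates and against the fixed point [f], where [D n] is the slack. The weighted sum of the
    [|e n|^2] is at most [|x 0 - f|^2], and [|e n|] is nonincreasing, so divergence of the weights
    forces [e n] to 0; then [D n <= -2 <x n - f, e n> - |e n|^2] follows. *)
Lemma krasnoselskii_mann (R : realType) (E : lmodType R) (B : E -> E -> R)
    (lam : nat -> R) (x e : nat -> E) (f : E) (D : nat -> R) :
  inner_form B ->
  (forall n, 0 <= lam n <= 1) ->
  [series lam n * (1 - lam n)]_n @ \oo --> +oo ->
  (forall n, x n.+1 = x n + lam n *: e n) ->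
  (forall n, B (x n.+1 - x n + (e n.+1 - e n)) (x n.+1 - x n + (e n.+1 - e n))
             <= B (x n.+1 - x n) (x n.+1 - x n)) ->
  (forall n, 0 <= D n) ->
  (forall n, B (x n - f + e n) (x n - f + e n) + D n <= B (x n - f) (x n - f)) ->
  [/\ cvgn (fun n => B (x n - f) (x n - f)),
      forall n, B (x n - f) (x n - f) <= B (x 0%N - f) (x 0%N - f),
      (fun n => B (e n) (e n)) @ \oo --> 0 & D @ \oo --> 0].
Proof.
move=> hB lam01 div xS nonexp D0 fejer.
pose a n := B (x n - f) (x n - f); pose r n := B (e n) (e n).
have a0 n : 0 <= a n by exact: iform_ge0.
have r0 n : 0 <= r n by exact: iform_ge0.
(* With [d = x n - f] and [l = lam n]: [|d + l e|^2 = (1 - l) |d|^2 + l |d + e|^2 - l (1 - l)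
   |e|^2]. *)
have aS n : lam n * (1 - lam n) * r n + a n.+1 <= a n.
  have := fejer n; have := D0 n; have /andP[l0 l1] := lam01 n.
  rewrite /a /r xS [x n + _ - f]addrAC /=.
  move: (x n - f) => d; rewrite !(iformE hB) (iformC hB (e n) d); nra.
(* Since [x n.+1 - x n = lam n *: e n], expanding [nonexp] bounds [lam n * (r n.+1 - r n)] by a
   nonpositive term; [lam n = 0] is separate and gives [e n.+1 = e n]. *)
have rS n : r n.+1 <= r n.
  have := nonexp n; have /andP[l0 l1] := lam01 n.
  rewrite /= [x n.+1]xS [x n + _]addrC addrK.
  have [->|ln0] := eqVneq (lam n) 0.
    rewrite scale0r add0r (iform0l hB) => h.
    have /(iform_eq0 hB)/subr0_eq eE : B (e n.+1 - e n) (e n.+1 - e n) = 0.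
      by apply/le_anti; rewrite h (iform_ge0 hB).
    by rewrite /r eE.
  have lp : 0 < lam n by rewrite lt_neqAle eq_sym ln0.
  have := iform_ge0 hB (e n.+1 - e n).
  rewrite !(iformE hB) (iformC hB (e n) (e n.+1)) -/(r n) -/(r n.+1) => h1 h2.
  rewrite -(ler_pM2l lp); nra.
have a_dec : nonincreasing_seq a.
  apply/nonincreasing_seqP => n; apply: le_trans (aS n).
  have /andP[l0 l1] := lam01 n.
  by rewrite lerDr !mulr_ge0 ?subr_ge0.
have r_dec : nonincreasing_seq r by apply/nonincreasing_seqP.
have r_to0 : r @ \oo --> 0.
  apply/cvgr0Pnorm_lt => eps eps0.
  suff [N rN] : exists N, r N < eps.
    exists N => // n /= Nn; rewrite ger0_norm //.
    exact: le_lt_trans (r_dec _ _ Nn) rN.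
  apply/not_existsP => h.
  have {}h n : eps <= r n by rewrite leNgt; apply/negP/h.
  have S n : eps * series (fun n => lam n * (1 - lam n)) n + a n <= a 0%N.
    elim: n => [|n IH]; first by rewrite /series /= big_geq // mulr0 add0r.
    rewrite /series /= in IH *; rewrite big_nat_recr //=.
    have /andP[l0 l1] := lam01 n.
    have c0 : 0 <= lam n * (1 - lam n) by apply: mulr_ge0; lra.
    have := aS n; have := ler_wpM2l c0 (h n); lra.
  move/cvgryPgt: div => /(_ (a 0%N / eps)) [N _ /(_ N (leqnn N))] /=.
  rewrite ltr_pdivrMr // => hN; have := S N; have := a0 N; lra.
have aC : cvgn a.
  by apply: nonincreasing_is_cvgn => //; exists 0 => _ [n _ <-].
split=> //; first by move=> n; exact: a_dec.
apply/cvgr0Pnorm_lt => eps eps0.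
(* Young's inequality with weight [s] gives [s * D n <= r n + s^2 * a 0]; this [s] makes
   [s * a 0 < eps / 2]. *)
pose s := eps / (2 * (a 0%N + 1)).
have A0 : 0 < 2 * (a 0%N + 1) by have := a0 0%N; lra.
have s0 : 0 < s by rewrite divr_gt0.
have sE : s * (2 * (a 0%N + 1)) = eps by rewrite divfK ?gt_eqF.
have D_le n : s * D n <= r n + s ^+ 2 * a 0%N.
  have := fejer n; have := iform_ge0 hB (e n + s *: (x n - f)).
  have : a n <= a 0%N by exact: a_dec.
  rewrite /= /a; move: (x n - f) => d; rewrite !(iformE hB) (iformC hB (e n) d).
  rewrite -!/(r n); have := r0 n; nra.
have se0 : 0 < s * eps / 2 by rewrite divr_gt0 // mulr_gt0.
move/cvgr0Pnorm_lt: r_to0 => /(_ _ se0); apply: filterS => n.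
rewrite !ger0_norm // => rn.
rewrite -(ltr_pM2l s0); have := D_le n; nra.
Qed.

(** Ultrafilters finer than [F] take the place of subsequences. If the preimage of a neighbourhood
    were not in [F], its complement would be compatible with [F], and an ultrafilter refining both
    would contradict the hypothesis. *)
Lemma cvg_ultra (T : topologicalType) (F : set_system nat) (u : nat -> T) (l : T) :
  ProperFilter F ->
  (forall U, UltraFilter U -> F `<=` U -> u @ U --> l) -> u @ F --> l.
Proof.
move=> FF h A Al; apply: contrapT => nFA.
pose G := within (~` (u @^-1` A)) F.
have GF : ProperFilter G.
  apply: Build_ProperFilter_ex => B GB; apply: contrapT => nB; apply: nFA.
  apply: (@filterS _ F _ _ (u @^-1` A) _ GB) => n nAB; apply: contrapT => nA.
  by apply: nB; exists n; apply: nAB.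
have [U [UU GU]] := ultraFilterLemma GF.
have FU : F `<=` U.
  by move=> B FB; apply: GU; apply: filterS FB => n Bn _.
have UA : U (u @^-1` A) := h U UU FU A Al.
have UC : U (~` (u @^-1` A)) by apply: GU; apply: (@filterE _ F).
by have [n []] := filter_ex (filterI UA UC).
Qed.

(** * Convergence and quadratic maximisation in a Hilbert space *)

Section InnerProduct.
Variables (R : realType) (H : completeNormedModType R) (ip : H -> H -> R).
Hypothesis hip : is_inner_product ip.

Lemma ip_inner_form : inner_form ip.
Proof.
case: hip => ipC [lin nrm]; split=> // x; rewrite nrm ?sqr_ge0 //.
by move/eqP; rewrite sqrf_eq0 normr_eq0 => /eqP.
Qed.

Lemma ip_norm x : ip x x = `|x| ^+ 2.
Proof. by case: hip => _ []. Qed.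

Let hs := ip_inner_form.

Lemma ip_cauchy_schwarz x y : `|ip x y| <= `|x| * `|y|.
Proof.
suff main u v : ip u v <= `|u| * `|v|.
  rewrite ler_norml main andbT lerNl -(iformNl hs).
  by rewrite (le_trans (main _ _)) ?normrN.
have [->|u0] := eqVneq u 0; first by rewrite (iform0l hs) normr0 mul0r.
have [->|v0] := eqVneq v 0; first by rewrite (iform0r hs) normr0 mulr0.
have nu : 0 < `|u| by rewrite normr_gt0.
have nv : 0 < `|v| by rewrite normr_gt0.
(* This square equals [2 |u| |v| (|u| |v| - <u, v>)]. *)
have := iform_ge0 hs (`|v| *: u - `|u| *: v).
rewrite !(iformE hs) !ip_norm (iformC hs v u).
move=> h; rewrite -subr_ge0 -(pmulr_rge0 _ (mulr_gt0 nu nv)).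
nra.
Qed.

Lemma cvg_ipl {T} (F : set_system T) (FF : Filter F) (u : T -> H) c w :
  u @ F --> c -> (fun t => ip (u t) w) @ F --> ip c w.
Proof.
move=> uc; apply/subr_cvg0; apply: norm_cvg0.
apply: (@squeeze_cvgr _ _ _ _ (cst 0) (fun t => `|u t - c| * `|w|)).
- apply: nearW => t; rewrite normr_ge0 /=.
  by have := ip_cauchy_schwarz (u t - c) w; rewrite !(iformE hs).
- exact: cvg_cst.
- rewrite -[X in _ --> X](mul0r `|w|); apply: cvgMl.
  rewrite -[X in _ --> X](@normr0 _ H); apply: cvg_norm.
  exact/subr_cvg0.
Qed.

(** Strong against weak convergence: the bound on [v] kills [<u - c, v>]. It is assumed explicitly
    because weak convergence along a general filter does not provide it. *)
Lemma cvg_ip_bounded {T} (F : set_system T) (FF : ProperFilter F)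
    (u v : T -> H) c d M :
  u @ F --> c -> (\forall t \near F, `|v t| <= M) ->
  (forall w, (fun t => ip (v t) w) @ F --> ip d w) ->
  (fun t => ip (u t) (v t)) @ F --> ip c d.
Proof.
move=> uc vM vd.
suff h : (fun t => ip (u t - c) (v t)) @ F --> 0.
  rewrite -[X in _ --> X]add0r (iformC hs c d).
  have -> : (fun t => ip (u t) (v t)) =
            (fun t => ip (u t - c) (v t) + ip (v t) c).
    by apply/funext => t; rewrite (iformC hs (v t) c) !(iformE hs) subrK.
  exact: cvgD.
apply: norm_cvg0.
apply: (@squeeze_cvgr _ _ _ _ (cst 0) (fun t => `|u t - c| * M)).
- near=> t; rewrite normr_ge0 /=.
  apply: (le_trans (ip_cauchy_schwarz _ _)).
  by rewrite ler_wpM2l //; near: t.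
- exact: cvg_cst.
- rewrite -[X in _ --> X](mul0r M); apply: cvgMl.
  rewrite -[X in _ --> X](@normr0 _ H); apply: cvg_norm.
  exact/subr_cvg0.
Unshelve. all: by end_near.
Qed.

Lemma cvg_sq_norm0 {T} (F : set_system T) (FF : Filter F) (u : T -> H) :
  (fun t => ip (u t) (u t)) @ F --> 0 -> u @ F --> (0 : H).
Proof.
move=> h; apply/cvgr0Pnorm_lt => e e0.
have e2 : 0 < e ^+ 2 by rewrite exprn_gt0.
move/cvgr0Pnorm_lt: h => /(_ _ e2); apply: filterS => t.
rewrite ip_norm normrX normr_id => h.
by rewrite -(@ltr_pXn2r _ 2%N) ?nnegrE // ltW.
Qed.

Lemma cvg_sq_norm {T} (F : set_system T) (FF : Filter F) (u : T -> H) c :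
  u @ F --> c -> (fun t => ip (u t) (u t)) @ F --> ip c c.
Proof.
move=> uc; rewrite ip_norm expr2.
under eq_fun do rewrite ip_norm expr2.
by apply: cvgM; apply: cvg_norm.
Qed.

(* A maximising sequence is Cauchy in its [v] component because [t - |v|^2] is
   strongly concave; the conclusion is the first-order condition at its limit. *)
Lemma concave_max (K : H -> R -> Prop) (M : R) :
  (exists v t, K v t) ->
  (forall (s : R) v t v' t', 0 <= s <= 1 -> K v t -> K v' t' ->
     K ((1 - s) *: v + s *: v') ((1 - s) * t + s * t')) ->
  (forall v t, K v t -> t - ip v v <= M) ->
  exists c, forall v t, K v t -> t + ip c c - 2 * ip c v <= M.
Proof.
move=> [v0 [t0 K0]] Kconv KM.
pose V := [set s | exists v t, K v t /\ s = t - ip v v].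
have supV : has_sup V.
  split; first by exists (t0 - ip v0 v0), v0, t0.
  by exists M => _ [v [t [/KM h ->]]].
set S := sup V.
have SM : S <= M.
  by apply: ge_sup; [case: supV|move=> _ [v [t [/KM h ->]]]].
have leS v t : K v t -> t - ip v v <= S.
  by move=> Kvt; apply: sup_upper_bound => //; exists v, t.
have /choice[k kP] (n : nat) :
    exists vt : H * R, K vt.1 vt.2 /\ S - n.+1%:R^-1 < vt.2 - ip vt.1 vt.1.
  have [|_ [v [t [Kvt ->]]] h] := @sup_adherent _ V n.+1%:R^-1 _ supV.
    by rewrite invr_gt0.
  by exists (v, t).
pose v n := (k n).1; pose d n : R := n.+1%:R^-1.
(* The midpoint of two near-maximisers has value their average plus [|v m - v n|^2 / 4], and this is
   at most [S]. *)
have cauchy_v m n : (m <= n)%N -> ip (v m - v n) (v m - v n) <= 4 * d m.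
  move=> mn; have [Km hm] := kP m; have [Kn hn] := kP n.
  have dnm : d n <= d m by rewrite lef_pV2 ?posrE // ler_nat ltnS.
  have := leS _ _ (Kconv (1/2) _ _ _ _ _ Km Kn).
  rewrite -/(v n) -/(v m) -/(d n) -/(d m) in hm hn *.
  rewrite !(iformE hs) (iformC hs (v n) (v m)) => h.
  have half01 : 0 <= (1 / 2 : R) <= 1 by lra.
  by have := h half01; lra.
have [w vw] : exists w : H, v @ \oo --> w.
  suff : cvg (v @ \oo) by move=> /cvg_ex[w vw]; exists w.
  apply: cauchy_cvg; apply: cauchy_exP => e e0.
  have e2 : 0 < e ^+ 2 / 4 by rewrite divr_gt0 // exprn_gt0.
  have := @cvg_harmonic R => /cvgr0Pnorm_lt /(_ _ e2) [N _ /(_ N (leqnn N))].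
  rewrite /= ger0_norm ?invr_ge0 // => hN.
  exists (v N), N => // n /= Nn; rewrite -ball_normE /=.
  rewrite -(@ltr_pXn2r _ 2%N) ?nnegrE ?(ltW e0) // -ip_norm.
  by have := cauchy_v _ _ Nn; rewrite -/(d N) in hN; lra.
exists w => v' t' Kvt; apply: le_trans SM.
(* Moving from [v n] a fraction [s] towards [v'] cannot exceed [S]; the limit in [n] leaves a
   first-order term in [s] against a second-order one. *)
have key s : 0 <= s <= 1 ->
    s * (t' - S + ip w w - 2 * ip w v') <= s ^+ 2 * ip (w - v') (w - v').
  move=> s01.
  apply: (@ler_cvg_to _ \oo _ _
    (fun n => s * (t' - S + ip (v n) (v n) - 2 * ip (v n) v'))
    (fun n => d n + s ^+ 2 * ip (v n - v') (v n - v'))).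
  - apply: cvgMr; apply: cvgB; first apply: cvgD.
    + exact: cvg_cst.
    + exact: cvg_sq_norm.
    + by apply: cvgMr; apply: cvg_ipl.
  - rewrite -[X in _ --> X]add0r; apply: cvgD; first exact: cvg_harmonic.
    by apply: cvgMr; apply: cvg_sq_norm; apply: cvgB => //; exact: cvg_cst.
  - apply: nearW => n; have [Kn hn] := kP n.
    have := leS _ _ (Kconv _ _ _ _ _ s01 Kn Kvt).
    have hS := leS _ _ Kn.
    rewrite -/(v n) -/(d n) in hn hS *.
    rewrite !(iformE hs) (iformC hs v' (v n)) => h.
    case/andP: s01 => s0 s1; nra.
set G := t' - S + _ - _ in key.
suff : G <= 0 by rewrite /G; lra.
rewrite leNgt; apply/negP => G0.
set Q := ip (w - v') (w - v') in key.
have Q0 : 0 <= Q by apply: iform_ge0.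
have D0 : 0 < Q + G + 1 by lra.
(* Chosen so that [0 < s < 1] and [s * Q < G], against [key]. *)
pose s := G / (Q + G + 1).
have s0 : 0 < s by rewrite divr_gt0.
have sE : s * (Q + G + 1) = G by rewrite divfK // gt_eqF.
have : s * G <= s ^+ 2 * Q by apply: key; nra.
rewrite expr2 -mulrA ler_pM2l // => h; nra.
Qed.

(** * Maximal monotonicity and Minty's theorem *)

(** Adjoining the single point [(y, u)] to the graph keeps it monotone, so maximality says that the
    point was already there. Later proofs use maximality in this pointwise form. *)
Lemma maximally_monotoneP (T : H -> set H) :
  maximally_monotone ip T <->
  monotone_op ip T /\
  forall y u, (forall a b, T a b -> 0 <= ip (y - a) (u - b)) -> T y u.
Proof.
split=> -[Tm Tmax]; split=> //.
- move=> y u yu.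
  rewrite -(Tmax (fun z => [set v | T z v \/ (z = y /\ v = u)])) /=; last 2 first.
  + move=> z1 z2 v1 v2 /= [h1|[-> ->]] [h2|[-> ->]]; [exact: Tm|
      |exact: yu|by rewrite !subrr (iform0l hs)].
    by rewrite -opprB -[v1 - u]opprB (iformNl hs) (iformNr hs) opprK yu.
  + by move=> z v /=; left.
  by right.
- move=> T' T'm TT' y; apply/seteqP; split=> [u T'u|u]; last exact: TT'.
  by apply: Tmax => a b Tab; apply: T'm T'u (TT' _ _ Tab).
Qed.

(** Epigraph of the Fenchel conjugate, with its two arguments exchanged, of the function described
    by [K]. For the graph of an operator with [s = <a, b>] it is the epigraph of the Fitzpatrick
    function. *)
Definition polar (K : H -> H -> R -> Prop) : H -> H -> R -> Prop :=
  fun a b s => forall a' b' s', K a' b' s' -> ip a b' + ip a' b <= s + s'.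

Lemma polar_convex K s a b t a' b' t' : 0 <= s <= 1 ->
  polar K a b t -> polar K a' b' t' ->
  polar K ((1 - s) *: a + s *: a') ((1 - s) *: b + s *: b')
    ((1 - s) * t + s * t').
Proof.
move=> /andP[s0 s1] Ka Ka' a1 b1 t1 K1; rewrite !(iformE hs).
have := Ka _ _ _ K1; have := Ka' _ _ _ K1.
nra.
Qed.

(* Along the graph of [T - x], with [s = <a, b>], monotonicity reads
   [K0 <= polar K0], so [polar (polar K0)] is a convex set that contains the
   graph and still satisfies [<a, b> <= s]. This makes [concave_max] applicable
   to [v = (b - a) / 2], [t = - s], and its maximiser is [- y]. *)
Theorem minty (T : H -> set H) x : maximally_monotone ip T ->
  exists y, T y (x - y).
Proof.
case/maximally_monotoneP => Tm Tmax.
pose K0 a b s := T a (b + x) /\ s = ip a b.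
have K01 a b s : K0 a b s -> polar K0 a b s.
  move=> [Tab ->] a' b' _ [Tab' ->].
  have := Tm _ _ _ _ Tab Tab'.
  by rewrite opprD addrACA subrr addr0 !(iformE hs); lra.
have K02 a b s : K0 a b s -> polar (polar K0) a b s.
  move=> K a' b' s' /(_ _ _ _ K); lra.
(* Polarity reverses inclusions, so [(a, b, s)] also lies in [polar K0]; pairing it with itself
   gives [2 <a, b> <= 2 s]. *)
have K22 a b s : polar (polar K0) a b s -> ip a b <= s.
  move=> K; suff /K : polar K0 a b s by lra.
  by move=> a' b' s' /K01 /K.
(* For an empty graph every point is vacuously monotonically related, so maximality would add
   one. *)
have [a0 [b0 Tab0]] : exists a b, T a b.
  apply/not_existsP => h; apply: (h 0); exists 0; apply: Tmax => a b Tab.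
  by case: (h a); exists b.
pose K v t := exists a b s,
  [/\ polar (polar K0) a b s, v = 2^-1 *: (b - a) & t = - s].
have [||v t|c cP] := @concave_max K 0.
- exists (2^-1 *: ((b0 - x) - a0)), (- ip a0 (b0 - x)), a0, (b0 - x), (ip a0 (b0 - x)).
  by split => //; apply: K02; split=> //; rewrite subrK.
- move=> s _ _ _ _ s01 [a [b [t [K1 -> ->]]]] [a' [b' [t' [K1' -> ->]]]].
  exists ((1 - s) *: a + s *: a'), ((1 - s) *: b + s *: b'), ((1 - s) * t + s * t').
  split; first exact: polar_convex.
  + rewrite !scalerA ![_ * 2^-1]mulrC -!scalerA -scalerDr; congr (_ *: _).
    by rewrite !scalerBr opprD addrACA.
  + by rewrite !mulrN opprD.
- move=> [a [b [s [K1 -> ->]]]]; have := K22 _ _ _ K1.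
  have := iform_ge0 hs (a + b); rewrite !(iformE hs) (iformC hs b a); lra.
(* At a point [(a, b)] of the graph the first-order condition reads [0 <= <- c - a, x + c - b>]. *)
- exists (- c); rewrite opprK; apply: Tmax => a b Tab.
  have /cP : K (2^-1 *: ((b - x) - a)) (- ip a (b - x)).
    exists a, (b - x), (ip a (b - x)); split=> //.
    by apply: K02; split=> //; rewrite subrK.
  rewrite !(iformE hs) (iformC hs a c); lra.
Qed.

Lemma maximally_monotone_scale_perturb (T : H -> set H) g w : 0 < g ->
  maximally_monotone ip T -> maximally_monotone ip (scale_op g (perturb_op w T)).
Proof.
move=> g0 /maximally_monotoneP[Tm Tmax]; apply/maximally_monotoneP; split.
  move=> y1 y2 _ _ [u1 T1 <-] [u2 T2 <-].
  rewrite -scalerBr (iformZr hs) mulr_ge0 ?(ltW g0) //.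
  by have := Tm _ _ _ _ T1 T2; rewrite opprB addrA subrK.
move=> y u yu; exists (g^-1 *: u); last by rewrite scalerA divff ?scale1r ?gt_eqF.
apply: Tmax => a b Tab.
have -> : y - w - a = y - (a + w) by rewrite [a + w]addrC opprD addrA.
rewrite -(pmulr_rge0 _ g0) -(iformZr hs) scalerBr scalerA.
rewrite divff ?gt_eqF // scale1r; apply: yu.
by exists b => //; rewrite /perturb_op addrK.
Qed.

Lemma resolventP (T : H -> set H) x : maximally_monotone ip T ->
  resolvent_op T x (resolvent T x).
Proof.
move=> TM; have [y Ty] := minty x TM; apply: getPex.
by exists y, (x - y); split=> //; rewrite addrC subrK.
Qed.

(** * Weak cluster points of bounded sequences *)

(* The Riesz representation of the functional [w |-> lim_U <u n, w>] is obtained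
   from [concave_max] applied to the graph of that functional. *)
Lemma weak_cluster (U : set_system nat) (u : nat -> H) M : UltraFilter U ->
  (forall n, `|u n| <= M) -> exists c, forall w, (fun n => ip (u n) w) @ U --> ip c w.
Proof.
move=> UU uM.
have bnd w n : `|ip (u n) w| <= M * `|w|.
  by rewrite (le_trans (ip_cauchy_schwarz _ _)) // ler_wpM2r.
(* A bounded real sequence has a cluster point along [U] by compactness, and a cluster point of an
   ultrafilter is a limit. *)
have /choice[phi phiP] w : exists l : R, (fun n => ip (u n) w) @ U --> l.
  have UC : (ip (u n) w @[n --> U]) `[- (M * `|w|), M * `|w|]%classic.
    by apply: (@filterE _ U) => n /=; rewrite in_itv /= -ler_norml.
  have [l [_ lc]] := @segment_compact R _ _ (ip (u n) w @[n --> U]) _ UC.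
  exists l => A Al.
  have [//|UA] := @in_ultra_setVsetC _ U ((fun n => ip (u n) w) @^-1` A) UU.
  by have [z []] := lc _ _ (UA : (ip (u n) w @[n --> U]) (~` A)) Al.
have phi_uniq w l : (fun n => ip (u n) w) @ U --> l -> phi w = l.
  by move=> h; apply: cvg_unique (phiP w) h.
have phiD v w : phi (v + w) = phi v + phi w.
  apply: phi_uniq; under eq_fun do rewrite (iformDr hs).
  exact: cvgD.
have phiZ a w : phi (a *: w) = a * phi w.
  apply: phi_uniq; under eq_fun do rewrite (iformZr hs).
  exact: cvgMr.
have phi_le v : phi v <= M * `|v|.
  apply: (@ler_cvg_to _ U _ _ (fun n => ip (u n) v) (cst (M * `|v|))) => //.
    exact: cvg_cst.
  by apply: nearW => n; rewrite (le_trans (ler_norm _)) //= bnd.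
have [||v _ ->|c cP] := @concave_max (fun v t => t = phi v) (M ^+ 2).
- by exists 0, (phi 0).
- by move=> s v _ v' _ _ -> ->; rewrite phiD !phiZ.
- rewrite ip_norm; have := phi_le v; nra.
(* [concave_max] bounds [s * D] by [M^2 - |c|^2] for every real [s], which forces [D = 0]. *)
have phiE v : phi v = 2 * ip c v.
  set D := phi v - 2 * ip c v; suff : D = 0 by rewrite /D; lra.
  apply/eqP; apply: contraT => D0.
  pose s := (M ^+ 2 + 1) / D.
  have := cP (s *: v) _ erefl; rewrite phiZ (iformZr hs).
  have : s * D = M ^+ 2 + 1 by rewrite divfK.
  have := iform_ge0 hs c; rewrite /D; lra.
by exists (2 *: c) => w; rewrite (iformZl hs) -phiE.
Qed.

Lemma ip_ext a b : (forall w, ip a w = ip b w) -> a = b.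
Proof.
move=> h; apply/subr0_eq/(iform_eq0 hs).
by rewrite (iformDl hs) (iformNl hs) h subrr.
Qed.

Lemma cvg_ip T (F : set_system T) (FF : Filter F) (u v : T -> H) c d :
  u @ F --> c -> v @ F --> d -> (fun t => ip (u t) (v t)) @ F --> ip c d.
Proof.
move=> uc vd.
have polarE a b : ip a b = 2^-1 * (ip (a + b) (a + b) - ip a a - ip b b).
  by rewrite !(iformE hs) (iformC hs b a); lra.
rewrite polarE; under eq_fun do rewrite polarE.
apply: cvgMr; apply: cvgB; first apply: cvgB.
- by apply: cvg_sq_norm => //; apply: cvgD.
- exact: cvg_sq_norm.
- exact: cvg_sq_norm.
Qed.

(** * The product space and one step of the method *)

Definition prod_ip r (u v : 'I_r -> H) : R := \sum_(i < r) ip (u i) (v i).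

Lemma prod_ip_inner_form r : inner_form (@prod_ip r).
Proof.
split.
- by move=> u v; apply: eq_bigr => i _; rewrite (iformC hs).
- move=> a u v w; rewrite /prod_ip mulr_sumr -big_split /=.
  by apply: eq_bigr => i _; rewrite !(iformE hs).
- by move=> u; apply: sumr_ge0 => i _; apply: iform_ge0.
- move=> u /psumr_eq0P h; apply/funext => i; apply: (iform_eq0 hs).
  by apply: h => // j _; apply: iform_ge0.
Qed.

Lemma prod_ip_component r (u : 'I_r -> H) i : ip (u i) (u i) <= prod_ip u u.
Proof.
rewrite /prod_ip (bigD1 i) //= lerDl.
by apply: sumr_ge0 => j _; apply: iform_ge0.
Qed.

Lemma cvg_component0 r (u : nat -> 'I_r -> H) :
  (fun n => prod_ip (u n) (u n)) @ \oo --> 0 ->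
  forall i, (fun n => u n i) @ \oo --> (0 : H).
Proof.
move=> h i; apply: cvg_sq_norm0.
apply: (squeeze_cvgr _ (cvg_cst 0) h).
by apply: nearW => n; rewrite (iform_ge0 hs) prod_ip_component.
Qed.

(** The inclusions say that [y] and [y'] are values at [s] and [s'] of the resolvent of [g T_(-q)].
    The shift [q] cancels in [y - y'], and monotonicity gives firm nonexpansiveness. *)
Lemma resolvent_firm (T : H -> set H) g q s y s' y' : 0 < g ->
  monotone_op ip T ->
  T (y + q) (g^-1 *: (s - y)) -> T (y' + q) (g^-1 *: (s' - y')) ->
  ip (y - y') (y - y') <= ip (y - y') (s - s').
Proof.
move=> g0 Tm h h'; have := Tm _ _ _ _ h h'.
rewrite opprD addrACA subrr addr0 -scalerBr (iformZr hs) pmulr_rge0 ?invr_gt0 //.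
by rewrite !(iformE hs); lra.
Qed.

(** All data are differences between two runs of the step. With [w i = 2 dp - dx i] one has
    [g i = 2 beta dy i - w i], so firmness yields [|g i|^2 <= |w i|^2 - 4 beta (1 - beta) |dy i|^2];
    and [w] has the norm of [dx], being its reflection through the diagonal. *)
Lemma reflected_step_nonexpansive r beta (dx dy g : 'I_r -> H) (dp : H) :
  0 <= beta -> \sum_(i < r) dx i = r%:R *: dp ->
  (forall i, ip (dy i) (dy i) <= ip (dy i) (2 *: dp - dx i)) ->
  (forall i, g i = dx i + 2 *: (beta *: dy i - dp)) ->
  prod_ip g g + 4 * beta * (1 - beta) * prod_ip dy dy <= prod_ip dx dx.
Proof.
move=> b0 sdx firm gE.
(* The added terms turn each summand into [|2 dp - dx i|^2] and sum to zero because [dp] is the mean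
   of [dx]. *)
have -> : prod_ip dx dx =
    \sum_(i < r) (ip (dx i) (dx i) + (4 * ip dp dp - 4 * ip (dx i) dp)).
  rewrite big_split /= -[LHS]addr0; congr (_ + _).
  rewrite big_split /= sumr_const card_ord sumrN -mulr_sumr -(iform_suml hs) sdx.
  by rewrite (iformZl hs) -mulr_natl; ring.
rewrite /prod_ip mulr_sumr -big_split /=; apply: ler_sum => i _.
have := firm i; rewrite gE !(iformE hs) (iformC hs (dy i) (dx i)).
rewrite (iformC hs dp (dx i)) (iformC hs dp (dy i)); nra.
Qed.

End InnerProduct.

Arguments prod_ip {R H} ip {r} u v.

(** * Convergence of the splitting iteration *)

Section Splitting.
Variables (R : realType) (H : completeNormedModType R) (ip : H -> H -> R).
Hypothesis hip : is_inner_product ip.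
Let hs := ip_inner_form hip.

Variables (r : nat) (A : 'I_r -> H -> set H) (gamma beta : R) (lam : nat -> R).
Variables (q : H) (x Y : 'I_r -> nat -> H).
Hypotheses (r0 : (0 < r)%N) (Am : forall i, maximally_monotone ip (A i)).
Hypotheses (g0 : 0 < gamma) (b01 : 0 < beta < 1).
Hypotheses (lam01 : forall n, 0 <= lam n <= 1)
  (lam_div : [series lam n * (1 - lam n)]_n @ \oo --> +oo).

Let p n := (r%:R)^-1 *: \sum_(i < r) x i n.

(* [Y i n] is the resolvent of [gamma (A i)_(-q)] at [2 p n - x i n]. *)
Hypothesis YP : forall i n,
  A i (Y i n + q) (gamma^-1 *: (2 *: p n - x i n - Y i n)).
Hypothesis xS : forall i n,
  x i n.+1 = x i n + lam n *: (2 *: (beta *: Y i n - p n)).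

Let X n : 'I_r -> H := fun i => x i n.
Let e n : 'I_r -> H := fun i => 2 *: (beta *: Y i n - p n).

(* [f] is a fixed point of the iteration whose mean is [beta *: y] and at which
   all the resolvents take the common value [y]. *)
Definition splitting_fixpoint (y : H) (f : 'I_r -> H) :=
  \sum_(i < r) f i = r%:R *: (beta *: y) /\
  forall i, A i (y + q) (gamma^-1 *: (2 *: (beta *: y) - f i - y)).

Let rn0 : r%:R != 0 :> R. Proof. by rewrite pnatr_eq0 -lt0n. Qed.

Let sumX n : \sum_(i < r) x i n = r%:R *: p n.
Proof. by rewrite /p scalerA divff // scale1r. Qed.

Lemma splitting_nonexpansive n :
  prod_ip ip (X n.+1 - X n + (e n.+1 - e n)) (X n.+1 - X n + (e n.+1 - e n))
  <= prod_ip ip (X n.+1 - X n) (X n.+1 - X n).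
Proof.
have /andP[b0 b1] := b01.
apply: (le_trans _ (@reflected_step_nonexpansive _ _ _ hip r beta _
  (fun i => Y i n.+1 - Y i n) (X n.+1 - X n + (e n.+1 - e n))
  (p n.+1 - p n) (ltW b0) _ _ _)).
- rewrite lerDl mulr_ge0 ?(iform_ge0 (prod_ip_inner_form hip r)) //; nra.
- have E : \sum_i (X n.+1 - X n) i = \sum_i (x i n.+1 - x i n) by [].
  by rewrite E sumrB !sumX scalerBr.
- move=> i; have [Amon _] := Am i; rewrite /=.
  suff -> : 2 *: (p n.+1 - p n) - (x i n.+1 - x i n) =
      (2 *: p n.+1 - x i n.+1) - (2 *: p n - x i n).
    exact: (resolvent_firm hip g0 Amon (YP i n.+1) (YP i n)).
  by rewrite scalerBr !opprD addrACA.
- move=> i; rewrite /e /=; congr (_ + _).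
  by rewrite -scalerBr; congr (_ *: _); rewrite scalerBr !opprD addrACA.
Qed.

Lemma splitting_fejer y f n : splitting_fixpoint y f ->
  prod_ip ip (X n - f + e n) (X n - f + e n) +
    4 * beta * (1 - beta) * prod_ip ip (fun i => Y i n - y) (fun i => Y i n - y)
  <= prod_ip ip (X n - f) (X n - f).
Proof.
move=> [sf fP]; have /andP[b0 b1] := b01.
apply: (@reflected_step_nonexpansive _ _ _ hip r beta _ _ _
  (p n - beta *: y) (ltW b0)).
- have E : \sum_i (X n - f) i = \sum_i (x i n - f i) by [].
  by rewrite E sumrB sumX sf -scalerBr.
- move=> i; have [Amon _] := Am i; rewrite /=.
  suff -> : 2 *: (p n - beta *: y) - (x i n - f i) =
      (2 *: p n - x i n) - (2 *: (beta *: y) - f i).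
    exact: (resolvent_firm hip g0 Amon (YP i n) (fP i)).
  by rewrite scalerBr !opprD addrACA.
- move=> i; rewrite /e /=; congr (_ + _ *: _).
  by rewrite scalerBr opprB addrA subrK.
Qed.

Lemma splitting_convergence y f : splitting_fixpoint y f ->
  [/\ cvgn (fun n => prod_ip ip (X n - f) (X n - f)),
      forall n, prod_ip ip (X n - f) (X n - f) <=
                prod_ip ip (X 0%N - f) (X 0%N - f),
      forall i, (fun n => x i n.+1 - x i n) @ \oo --> (0 : H),
      forall i, Y i @ \oo --> y & p @ \oo --> beta *: y].
Proof.
move=> fix_f; have /andP[b0 b1] := b01.
have hp := prod_ip_inner_form hip r.
have k0 : 0 < 4 * beta * (1 - beta) by rewrite !mulr_gt0 ?subr_gt0.
have [||||aC aB eC DC] := @krasnoselskii_mann _ _ (prod_ip ip) lam X e f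
  (fun n => 4 * beta * (1 - beta) *
            prod_ip ip (fun i => Y i n - y) (fun i => Y i n - y)) hp lam01 lam_div.
- by move=> n; apply/funext => i; rewrite /X /= xS.
- exact: splitting_nonexpansive.
- by move=> n; rewrite mulr_ge0 ?(ltW k0) ?(iform_ge0 hp).
- by move=> n; exact: splitting_fejer.
have ei i : (fun n => e n i) @ \oo --> (0 : H) by exact: (cvg_component0 hip eC).
have Yi i : Y i @ \oo --> y.
  apply/subr_cvg0; apply: (@cvg_component0 _ _ _ hip r (fun n j => Y j n - y)).
  rewrite -[X in _ --> X](mulr0 (4 * beta * (1 - beta))^-1).
  under eq_fun do rewrite -[prod_ip _ _ _](mulKf (lt0r_neq0 k0)).
  exact: cvgMr.
split=> // [i|].
- apply: (cvg_sq_norm0 hip).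
  have h : (fun n => ip (e n i) (e n i)) @ \oo --> 0.
    by rewrite -[X in _ --> X](iform0l hs 0); apply: cvg_ip.
  apply: (squeeze_cvgr _ (cvg_cst 0) h).
  apply: nearW => n; rewrite (iform_ge0 hs) xS [x i n + _]addrC addrK.
  have /andP[l0 l1] := lam01 n.
  by rewrite /= -/(e n i) (iformZl hs) (iformZr hs) mulrA ler_piMl ?mulr_ile1 ?(iform_ge0 hs).
- pose i := Ordinal r0.
  have -> : p = fun n => beta *: Y i n - 2^-1 *: e n i.
    apply/funext => n; rewrite /e scalerA mulVf // scale1r opprB.
    by rewrite addrC subrK.
  rewrite -[X in _ --> X]subr0; apply: cvgB; first exact: cvgZr.
  by rewrite -[X in _ --> X](scaler0 _ 2^-1); apply: cvgZr.
Qed.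

(** The [x i] converge only weakly along [U], but in the monotonicity inequality they are paired
    with [Y i n + q - s], which converges strongly; the inequality thus passes to the limit and
    maximality of [A i] applies. *)
Lemma splitting_weak_cluster y f (U : set_system nat) :
  splitting_fixpoint y f -> UltraFilter U -> \oo `<=` U ->
  exists c, splitting_fixpoint y c /\
    forall i w, (fun n => ip (x i n) w) @ U --> ip (c i) w.
Proof.
move=> fix_f UU ooU; have [_ aB _ Yi pC] := splitting_convergence fix_f.
set a := prod_ip _ _ _ in aB.
(* [|x i n - f i|^2 <= a] implies [|x i n - f i| <= a + 1], which avoids a square root. *)
have xb i n : `|x i n| <= `|f i| + (a + 1).
  rewrite -[x i n](subrK (f i)) (le_trans (ler_normD _ _)) // addrC lerD2l.
  have := le_trans (prod_ip_component hip (X n - f) i) (aB n).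
  by rewrite (ip_norm hip) /=; have := normr_ge0 (x i n - f i); nra.
have /choice[c cP] i := weak_cluster hip UU (xb i).
exists c; split=> //.
have YU i : Y i @ U --> y by apply: cvg_trans (Yi i); exact: cvg_app.
have pU : p @ U --> beta *: y by apply: cvg_trans pC; exact: cvg_app.
split.
- apply: (ip_ext hip) => w.
  apply: (@cvg_unique _ (@Rhausdorff R) ((fun n => ip (r%:R *: p n) w) @ U)).
    rewrite (iform_suml hs).
    have -> : (fun n => ip (r%:R *: p n) w) = (fun n => \sum_i ip (x i n) w).
      by apply/funext => n; rewrite -sumX (iform_suml hs).
    by apply: cvg_big => [|i _]; first exact: add_continuous; exact: cP.
  by apply: (cvg_ipl hip); apply: cvgZr.
- move=> i; have /(maximally_monotoneP hip)[Amon Amax] := Am i.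
  apply: Amax => s t Ast.
  pose u n := Y i n + q - s.
  pose v n := gamma^-1 *: (2 *: p n - Y i n) - t.
  have uU : u @ U --> y + q - s.
    by apply: cvgB; [apply: cvgD => //; exact: cvg_cst|exact: cvg_cst].
  have vU : v @ U --> gamma^-1 *: (2 *: (beta *: y) - y) - t.
    apply: cvgB; last exact: cvg_cst.
    by apply: cvgZr; apply: cvgB => //; apply: cvgZr.
  have vE a1 s1 y1 x1 : ip a1 (gamma^-1 *: (s1 - x1 - y1) - t) =
      ip a1 (gamma^-1 *: (s1 - y1) - t) - gamma^-1 * ip x1 a1.
    rewrite (iformC hs x1) -(iformZr hs) -(iformNr hs) -(iformDr hs).
    by rewrite [in RHS]addrAC -scalerBr [s1 - y1 - x1]addrAC.
  rewrite vE.
  apply: (@ler_cvg_to _ U _ _ (cst 0) (fun n => ip (u n) (v n) - gamma^-1 * ip (x i n) (u n))).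
  - exact: cvg_cst.
  - apply: cvgB; first exact: cvg_ip.
    apply: cvgMr.
    under eq_fun do rewrite (iformC hs (x i _)).
    rewrite (iformC hs (c i)); apply: (cvg_ip_bounded hip) => //.
    by apply: nearW => n; exact: xb.
  - apply: nearW => n.
    by have := Amon _ _ _ _ (YP i n) Ast; rewrite vE.
Qed.

(* Opial's argument: [<X n, f - f'>] converges, being a difference of the
   convergent sequences [|X n - f'|^2] and [|X n - f|^2] up to constants. *)
Lemma splitting_cluster_unique y f f' (U V : set_system nat) :
  splitting_fixpoint y f -> splitting_fixpoint y f' ->
  ProperFilter U -> ProperFilter V -> \oo `<=` U -> \oo `<=` V ->
  (forall i w, (fun n => ip (x i n) w) @ U --> ip (f i) w) ->
  (forall i w, (fun n => ip (x i n) w) @ V --> ip (f' i) w) -> f = f'.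
Proof.
move=> fix_f fix_f' UU VV ooU ooV fU f'V.
have hp := prod_ip_inner_form hip r.
have [/cvg_ex[l1 l1P] _ _ _ _] := splitting_convergence fix_f.
have [/cvg_ex[l2 l2P] _ _ _ _] := splitting_convergence fix_f'.
have [l lP] : exists l : R, (fun n => prod_ip ip (X n) (f - f')) @ \oo --> l.
  exists (2^-1 * (l2 - l1 + (prod_ip ip f f - prod_ip ip f' f'))).
  have -> : (fun n => prod_ip ip (X n) (f - f')) = (fun n => 2^-1 *
      (prod_ip ip (X n - f') (X n - f') - prod_ip ip (X n - f) (X n - f)
       + (prod_ip ip f f - prod_ip ip f' f'))).
    apply/funext => n; rewrite !(iformE hp) (iformC hp f (X n)) (iformC hp f' (X n)).
    lra.
  by apply: cvgMr; apply: cvgD; [exact: cvgB|exact: cvg_cst].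
have lim W h : ProperFilter W -> \oo `<=` W ->
    (forall i w, (fun n => ip (x i n) w) @ W --> ip (h i) w) ->
    prod_ip ip h (f - f') = l.
  move=> WW ooW hW.
  apply: (@cvg_unique _ (@Rhausdorff R) ((fun n => prod_ip ip (X n) (f - f')) @ W)).
    by apply: cvg_big => [|i _]; first exact: add_continuous; exact: hW.
  by apply: cvg_trans lP; exact: cvg_app.
(* Both [<f, f - f'>] and [<f', f - f'>] equal [l], so [|f - f'|^2 = 0]. *)
apply/subr0_eq/(iform_eq0 hp).
by rewrite {1}(iformDl hp) (iformNl hp) (lim U f) // (lim V f') // subrr.
Qed.

(** One ultrafilter supplies the candidate [c]; the cluster point along any other ultrafilter finer
    than [\oo] coincides with it, so [cvg_ultra] applies. *)
Lemma splitting_weak_cvg y f : splitting_fixpoint y f ->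
  exists c, splitting_fixpoint y c /\ forall i, weak_cvg ip (x i) (c i).
Proof.
move=> fix_f; have [U [UU ooU]] := @ultraFilterLemma _ (\oo : set_system nat) _.
have [c [fix_c cU]] := splitting_weak_cluster fix_f UU ooU.
exists c; split=> // i w; apply: cvg_ultra => V VV ooV.
have [c' [fix_c' cV]] := splitting_weak_cluster fix_f VV ooV.
by rewrite (splitting_cluster_unique fix_c fix_c' _ _ ooU ooV cU cV).
Qed.

End Splitting.

(** * From the resolvent of the sum to fixed points of the iteration *)

Theorem theorem4p6 (R : realType) (H : completeNormedModType R)
  (ip : H -> H -> R) (r : nat) (A : 'I_r -> H -> set H)
  (gamma : R) (lam : nat -> R) (beta : R) (q : H)
  (x : 'I_r -> nat -> H) :
  is_inner_product ip ->
  (0 < r)%N ->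
  (forall i, maximally_monotone ip (A i)) ->
  0 < gamma ->
  (forall n, 0 <= lam n <= 1) ->
  [series lam n * (1 - lam n)]_n @ \oo --> +oo ->
  0 < beta < 1 ->
  q \in ran_IdplusT (scale_op (gamma / (r%:R * (1 - beta))) (sum_op A)) ->
  (forall i n,
     x i n.+1 = (1 - lam n) *: x i n + lam n *:
       ((2 * beta) *: resolvent (scale_op gamma (perturb_op (- q) (A i)))
                         (2 *: ((r%:R)^-1 *: \sum_(j < r) x j n) - x i n)
        - (2 *: ((r%:R)^-1 *: \sum_(j < r) x j n) - x i n))) ->
  (* (i) *)
  (forall i, (fun n => x i n.+1 - x i n) @ \oo --> (0 : H)) /\
  (* (ii) *)
  (exists xstar : 'I_r -> H,
     (forall i, weak_cvg ip (x i) (xstar i)) /\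
     resolvent_op (scale_op (gamma / (r%:R * (1 - beta))) (sum_op A)) q
       = [set q + (beta * r%:R)^-1 *: \sum_(i < r) xstar i]) /\
  (* (iii) *)
  (forall z, resolvent_op (scale_op (gamma / (r%:R * (1 - beta))) (sum_op A)) q z ->
     (fun n => q + beta^-1 *: ((r%:R)^-1 *: \sum_(i < r) x i n)) @ \oo --> z).
Proof.
move=> hip r0 Am g0 lam01 lam_div b01 /set_mem[z0 [u0 Tz0]] xrec.
have /andP[b0 b1] := b01.
pose p n := (r%:R)^-1 *: \sum_(i < r) x i n.
pose Y i n := resolvent (scale_op gamma (perturb_op (- q) (A i))) (2 *: p n - x i n).
have YP i n : A i (Y i n + q) (gamma^-1 *: (2 *: p n - x i n - Y i n)).
  have := resolventP hip (2 *: p n - x i n)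
    (maximally_monotone_scale_perturb hip (- q) g0 (Am i)).
  move=> [_ [[v Av <-] ->]]; rewrite -/(Y i n) [_ + gamma *: v]addrC addrK.
  by rewrite scalerA mulVf ?gt_eqF // scale1r -[q]opprK.
have xS i n : x i n.+1 = x i n + lam n *: (2 *: (beta *: Y i n - p n)).
  rewrite xrec -/(p n) -/(Y i n) scalerBl scale1r -addrA; congr (_ + _).
  rewrite opprB addrA [_ + x i n]addrC -!addrA.
  rewrite scalerDr addrA addNr add0r -scalerA -scalerBr.
  by rewrite addrC.
have rn0 : r%:R != 0 :> R by rewrite pnatr_eq0 -lt0n.
(* With [y = z - q] and [u i] in [A i z], the second fixed-point condition dictates
   [f i = 2 beta y - y - gamma u i]. The resolvent equation is [gamma * sum u = - r (1 - beta) y],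
   which gives [f] the mean [beta y]. *)
have fixP z : resolvent_op (scale_op (gamma / (r%:R * (1 - beta))) (sum_op A)) q z ->
    exists f, splitting_fixpoint A gamma beta q (z - q) f.
  move=> [_ [[_ [u [Au ->]] <-] qE]]; set y := z - q.
  exists (fun i => 2 *: (beta *: y) - y - gamma *: u i); split.
    rewrite sumrB sumr_const card_ord -scaler_sumr -scaler_nat.
    have -> : gamma *: \sum_(i < r) u i = - ((r%:R * (1 - beta)) *: y).
      rewrite /y qE opprD addrA subrr add0r scalerN opprK scalerA.
      by rewrite mulrC divfK // mulf_neq0 // subr_eq0 eq_sym lt_eqF.
    rewrite opprK -scalerA -scalerDr; congr (_ *: _).
    rewrite scalerBl scale1r addrA subrK scalerA -scalerBl.
    by congr (_ *: _); ring.
  move=> i; rewrite {1}/y subrK.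
  have -> a : a - (a - y - gamma *: u i) - y = gamma *: u i.
    by rewrite -[a - y - _]addrA -opprD subKr addrAC subrr add0r.
  by rewrite scalerA mulVf ?gt_eqF // scale1r.
have core z : resolvent_op (scale_op (gamma / (r%:R * (1 - beta))) (sum_op A)) q z ->
    (fun n => q + beta^-1 *: p n) @ \oo --> z.
  move=> /fixP[f fix_f].
  have [_ _ _ _ pC] := splitting_convergence hip r0 Am g0 b01 lam01 lam_div YP xS fix_f.
  have -> : z = q + beta^-1 *: (beta *: (z - q)).
    by rewrite scalerA mulVf ?gt_eqF // scale1r addrC subrK.
  by apply: cvgD; [exact: cvg_cst|exact: cvgZr].
have res0 : resolvent_op (scale_op (gamma / (r%:R * (1 - beta))) (sum_op A)) q z0.
  by case: Tz0 => Tz0 qE; exists u0.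
have [f fix_f] := fixP _ res0.
split; last split; last exact: core.
  by have [] := splitting_convergence hip r0 Am g0 b01 lam01 lam_div YP xS fix_f.
have [c [[sc _] cw]] :=
  splitting_weak_cvg hip r0 Am g0 b01 lam01 lam_div YP xS fix_f.
exists c; split=> //.
have -> : q + (beta * r%:R)^-1 *: \sum_(i < r) c i = z0.
  rewrite sc [r%:R *: _]scalerA scalerA [r%:R * _]mulrC mulVf ?scale1r ?(addrC q) ?subrK //.
  by apply: mulf_neq0 => //; rewrite gt_eqF.
(* Single-valuedness at [q] comes from (iii): every element of the resolvent is the strong limit of
   the same sequence. *)
apply/seteqP; split=> [z zres|_ ->] //=.
exact: cvg_unique (core _ zres) (core _ res0).
Qed.
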